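(* Let $Y^1$ and $Y^2$ be independent, invertible, right unitarily invariant $N\times N$ random matrices with QR decompositions $Y^1=U^1R^1$ and $Y^2=U^2R^2$, and let $Y^3=Y^1Y^2=U^3R^3$ be the QR decomposition of their product. Then for each $k\in\{1,\dots,N\}$ there is the equality in law $$R^3_{kk}\overset{d}{=}R^1_{kk}\cdot R^2_{kk}.$$
   Context: A random matrix $Y$ is right unitarily invariant if $YU\overset{d}{=}Y$ for every unitary $U$. The QR decomposition of an invertible matrix $Y$ is $Y=UR$ with $U$ unitary and $R$ upper triangular with positive diagonal entries (equivalently, $Y^*Y=R^*R$ is the Cholesky decomposition of $Y^*Y$). *)

(* Defs.v *)
From HB Require Import structures.
From mathcomp Require Import all_boot all_order all_algebra.
From mathcomp Require Import complex.
From mathcomp Require Import all_classical all_reals all_analysis.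

Set Implicit Arguments.
Unset Strict Implicit.
Unset Printing Implicit Defensive.

Import Order.TTheory GRing.Theory Num.Theory.
Local Open Scope classical_set_scope.
Local Open Scope ring_scope.
Local Open Scope sesquilinear_scope.

(* The Borel sigma-algebra of R[i], identified with R * R through Re and Im. *)
Definition complex_display : measure_display. Proof. by constructor. Qed.

Section complex_measurable.
Variable R : realType.

HB.instance Definition _ := isPointed.Build R[i] 0.

Let M : set (set R[i]) := g_sigma_preimageU (@complex.Re R) (@complex.Im R).

Let complex_measurable0 : M set0.
Proof. exact: sigma_algebra0. Qed.

Let complex_measurableC A : M A -> M (~` A).
Proof. exact: sigma_algebraC. Qed.

Let complex_measurable_bigcup (F : (set R[i])^nat) :
  (forall k, M (F k)) -> M (\bigcup_k F k).
Proof. exact: sigma_algebra_bigcup. Qed.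

HB.instance Definition _ := @isMeasurable.Build complex_display R[i] M
  complex_measurable0 complex_measurableC complex_measurable_bigcup.

End complex_measurable.

(* The sigma-algebra generated by the entries, i.e. the product one. *)
Definition matrix_display : measure_display -> measure_display.
Proof. exact. Qed.

Section matrix_measurable.
Context d (T : measurableType d) (m n : nat).

Let M : set (set 'M[T]_(m, n)) :=
  <<s \bigcup_(ij in [set: 'I_m * 'I_n])
        preimage_set_system setT (fun A : 'M[T]_(m, n) => A ij.1 ij.2)
          measurable >>.

Let matrix_measurable0 : M set0.
Proof. exact: sigma_algebra0. Qed.

Let matrix_measurableC A : M A -> M (~` A).
Proof. exact: sigma_algebraC. Qed.

Let matrix_measurable_bigcup (F : (set 'M[T]_(m, n))^nat) :
  (forall k, M (F k)) -> M (\bigcup_k F k).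
Proof. exact: sigma_algebra_bigcup. Qed.

HB.instance Definition _ :=
  @isMeasurable.Build (matrix_display d) 'M[T]_(m, n) M
    matrix_measurable0 matrix_measurableC matrix_measurable_bigcup.

End matrix_measurable.

Section random_variables.
Context d (Omega : measurableType d) (R : realType) (P : probability Omega R).

(* Measurability of both sides is part of the definition: the values of a
   measure on non-measurable sets carry no information. *)
Definition eq_in_law d' (T : measurableType d') (X Y : Omega -> T) : Prop :=
  [/\ measurable_fun setT X, measurable_fun setT Y &
      forall B : set T, measurable B -> P (X @^-1` B) = P (Y @^-1` B)].

Definition independent_RV d1 d2 (T1 : measurableType d1)
    (T2 : measurableType d2) (X1 : {RV P >-> T1}) (X2 : {RV P >-> T2}) : Prop :=
  forall (B1 : set T1) (B2 : set T2), measurable B1 -> measurable B2 ->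
    P (X1 @^-1` B1 `&` X2 @^-1` B2)
    = (P (X1 @^-1` B1) * P (X2 @^-1` B2))%E.

Definition right_unitarily_invariant N (Y : {RV P >-> 'M[R[i]]_N}) : Prop :=
  forall U : 'M[R[i]]_N, U \is unitarymx ->
    eq_in_law (fun w => Y w *m U) Y.

End random_variables.

Definition is_QR (R : realType) N (Y U T : 'M[R[i]]_N) : Prop :=
  [/\ Y = U *m T, U \is unitarymx,
      forall i j : 'I_N, (j < i)%N -> T i j = 0 &
      forall i : 'I_N, 0 < T i i].

(* The QR factors of Y as a pair; the junk value (1, 1) is only taken when Y is
   not invertible, see QR_P. *)
Definition QR (R : realType) N (Y : 'M[R[i]]_N) : 'M[R[i]]_N * 'M[R[i]]_N :=
  xget (1%:M, 1%:M) [set UT | is_QR Y UT.1 UT.2].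

Definition QR_R (R : realType) N (Y : 'M[R[i]]_N) : 'M[R[i]]_N := (QR Y).2.

Section QR_theory.
Context (R : realType) (N : nat).
Implicit Types Y U T : 'M[R[i]]_N.

Lemma is_QR_exists Y : Y \in unitmx -> exists U T, is_QR Y U T.
Proof.
move=> Yu; pose A := Y^T; pose B := schmidt A.
have Bu : B \is unitarymx by exact: schmidt_unitarymx.
have Au : A \in unitmx by rewrite unitmx_tr.
have entryE i j : (A *m B^t*) i j = dotmx (row i A) (row j B).
  by rewrite dotmxE !mxE; apply: eq_bigr => k _; rewrite !mxE.
have Lu : A *m B^t* \in unitmx.
  by rewrite unitmx_mul Au unitarymx_unit// trmxC_unitary.
have tri (i j : 'I_N) : (i < j)%N -> (A *m B^t*) i j = 0.
  move=> ij; rewrite entryE dotmxE.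
  suff /sub_kermxP -> : (row i A <= kermx ((row j B)^t*))%MS by rewrite mxE.
  apply: submx_trans (row_schmidt_sub A i) _.
  apply/sumsmx_subP => k ki; rewrite genmxE; apply/sub_kermxP/matrixP => p q.
  rewrite !ord1 -dotmxE; have /row_unitarymxP -> := Bu.
  rewrite mxE; case: eqVneq => // kj; move: ij; rewrite -kj.
  by rewrite ltnNge; move: ki => /= ->.
exists B^T, (A *m B^t*)^T; split.
- by rewrite -trmx_mul mulmxKtV// trmxK.
- by rewrite trmx_unitary.
- by move=> i j ji; rewrite mxE tri.
- move=> i; rewrite mxE lt_neqAle eq_sym {2}entryE form1_row_schmidt andbT.
  apply/negP => Lii0; move: Lu; rewrite unitmxE det_trig; last exact/is_trig_mxP.
  by rewrite (bigD1 i)//= (eqP Lii0) mul0r unitr0.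
Qed.

Let upper_quotient (T T' W : 'M[R[i]]_N) :
    (forall i j : 'I_N, (j < i)%N -> T i j = 0) ->
    (forall i j : 'I_N, (j < i)%N -> T' i j = 0) ->
    (forall i, 0 < T' i i) -> T = W *m T' ->
  (forall i j : 'I_N, (j < i)%N -> W i j = 0) /\
  (forall i, T i i = W i i * T' i i).
Proof.
move=> Ttri Ttri' Tpos' TE.
have Wtri (i j : 'I_N) : (j < i)%N -> W i j = 0.
  have [m] := ubnP (val j); elim: m j => // m IH j jm ji.
  have := Ttri _ _ ji; rewrite TE mxE (bigD1 j)//= big1 ?addr0 => [|k kj].
    by move/eqP; rewrite mulf_eq0 (gt_eqF (Tpos' j)) orbF => /eqP.
  move: kj; rewrite neq_ltn => /orP[kj|jk]; last by rewrite Ttri' ?mulr0.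
  by rewrite IH ?mul0r//; [exact: leq_trans kj jm|exact: ltn_trans kj ji].
split=> // i; rewrite TE mxE (bigD1 i)//= big1 ?addr0// => k.
rewrite neq_ltn => /orP[ki|ik]; first by rewrite Wtri ?mul0r.
by rewrite Ttri' ?mulr0.
Qed.

Lemma is_QR_unique Y U T U' T' :
  is_QR Y U T -> is_QR Y U' T' -> U = U' /\ T = T'.
Proof.
move=> [YE Uu Ttri Tpos] [YE' Uu' Ttri' Tpos'].
pose W := U^t* *m U'.
have UU : U^t* *m U = 1%:M by have := mulmxKtV 1%:M Uu erefl; rewrite mul1mx.
have UU' : U'^t* *m U' = 1%:M by have := mulmxKtV 1%:M Uu' erefl; rewrite mul1mx.
have TE : T = W *m T' by rewrite /W -mulmxA -YE' YE mulmxA UU mul1mx.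
have WC : W^t* = U'^t* *m U by rewrite /W trmx_mul map_mxM trmxCK.
have TE' : T' = W^t* *m T by rewrite WC -mulmxA -YE YE' mulmxA UU' mul1mx.
have [Wtri Wd] := upper_quotient Ttri Ttri' Tpos' TE.
have [Wtri' _] := upper_quotient Ttri' Ttri Tpos TE'.
have Wu : W \is unitarymx by rewrite mul_unitarymx ?trmxC_unitary.
have UW : U *m W = U' by rewrite mulmxA (unitarymxP Uu) mul1mx.
have {UU UU' WC}W1 : W = 1%:M.
  clearbody W.
  apply/matrixP => i j; rewrite mxE.
  case: (ltngtP i j) => [ij|ji|/val_inj ->].
  - have := Wtri' _ _ ij; rewrite !mxE => /eqP; rewrite conjC_eq0 => /eqP ->.
    by rewrite -val_eqE/= ltn_eqF.
  - by rewrite Wtri// -val_eqE/= gtn_eqF.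
  - have /unitarymxP/matrixP/(_ j j) := Wu.
    rewrite !mxE (bigD1 j)//= big1 ?addr0 => [|k kj]; last first.
      move: kj; rewrite neq_ltn => /orP[kj|jk]; first by rewrite Wtri ?mul0r.
      by have := Wtri' _ _ jk; rewrite !mxE => ->; rewrite mulr0.
    rewrite !mxE eqxx/= => WW.
    have Wj : 0 < W j j by rewrite -(pmulr_lgt0 _ (Tpos' j)) -Wd.
    by move/eqP: WW; rewrite geC0_conj ?ltW// -expr2 sqrp_eq1 ?ltW// => /eqP ->.
split; last by rewrite TE W1 mul1mx.
by rewrite -UW W1 mulmx1.
Qed.

Lemma QR_P Y : Y \in unitmx -> is_QR Y (QR Y).1 (QR Y).2.
Proof.
move=> /is_QR_exists[U [T UT]].
exact: (@xgetI _ _ [set UT | is_QR Y UT.1 UT.2] (U, T) UT).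
Qed.

End QR_theory.

(* Main.v *)
(** With Y2 = U2 R2, the product Y1 Y2 = (Y1 U2) R2 has triangular QR factor
    R' R2, where R' is the triangular QR factor of Y1 U2; hence
    R3_kk = R'_kk * R2_kk.  Conditionally on Y2 the matrix U2 is a fixed
    unitary, so by Fubini and the right invariance of Y1 the pairs (Y2, Y1 U2)
    and (Y2, Y1) have the same law.  Measurability of the QR factors comes from
    the Gram-Schmidt recursion on the columns of U. *)

Require Import Defs.
From mathcomp Require Import all_boot all_order all_algebra.
From mathcomp Require Import complex.
From mathcomp Require Import all_classical all_reals all_analysis.
From mathcomp Require Import measurable_realfun.

Set Implicit Arguments.
Unset Strict Implicit.
Unset Printing Implicit Defensive.

Import Order.TTheory GRing.Theory Num.Theory.
Local Open Scope classical_set_scope.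
Local Open Scope ring_scope.
Local Open Scope sesquilinear_scope.

(** * Measurability of complex arithmetic *)

Section complex_measurable_fun.
Context d (T : measurableType d) (R : realType).
Implicit Types (D : set T) (f g : T -> R[i]).

Lemma measurable_Re : measurable_fun [set: R[i]] (@complex.Re R).
Proof. by move=> _ A mA; apply: sub_sigma_algebra; left; exists A. Qed.

Lemma measurable_Im : measurable_fun [set: R[i]] (@complex.Im R).
Proof. by move=> _ A mA; apply: sub_sigma_algebra; right; exists A. Qed.

(** Preimages of Borel sets under [Re] and [Im] generate the sigma-algebra of [R[i]], so it suffices
    to test measurability on them. *)
Lemma measurable_complexP D f :
  measurable_fun D f <->
  measurable_fun D (fun x => complex.Re (f x)) /\
  measurable_fun D (fun x => complex.Im (f x)).
Proof.
split=> [mf|[mr mi]].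
  by split; apply: measurableT_comp mf;
    [exact: measurable_Re|exact: measurable_Im].
move=> mD; apply: (measurability
  (preimage_set_system setT (@complex.Re R) measurable `|`
   preimage_set_system setT (@complex.Im R) measurable)) => //.
move=> _ [_ [[A mA <-]|[A mA <-]] <-]; rewrite setTI.
- exact: mr.
- exact: mi.
Qed.

Lemma measurable_cfunD D f g : measurable_fun D f -> measurable_fun D g ->
  measurable_fun D (fun x => f x + g x).
Proof.
move=> /measurable_complexP[fr fi] /measurable_complexP[gr gi].
apply/measurable_complexP; split.
- rewrite (_ : (fun _ => _) = (fun x => complex.Re (f x) + complex.Re (g x))).
    exact: measurable_funD.
  by apply/funext => x; case: (f x); case: (g x).
- rewrite (_ : (fun _ => _) = (fun x => complex.Im (f x) + complex.Im (g x))).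
    exact: measurable_funD.
  by apply/funext => x; case: (f x); case: (g x).
Qed.

Lemma measurable_cfunN D f : measurable_fun D f ->
  measurable_fun D (fun x => - f x).
Proof.
move=> /measurable_complexP[fr fi]; apply/measurable_complexP; split.
- rewrite (_ : (fun _ => _) = (fun x => - complex.Re (f x))).
    exact: measurable_funN.
  by apply/funext => x; case: (f x).
- rewrite (_ : (fun _ => _) = (fun x => - complex.Im (f x))).
    exact: measurable_funN.
  by apply/funext => x; case: (f x).
Qed.

Lemma measurable_cfunM D f g : measurable_fun D f -> measurable_fun D g ->
  measurable_fun D (fun x => f x * g x).
Proof.
move=> /measurable_complexP[fr fi] /measurable_complexP[gr gi].
apply/measurable_complexP; split.
- rewrite (_ : (fun _ => _) = (fun x =>
    complex.Re (f x) * complex.Re (g x) - complex.Im (f x) * complex.Im (g x))).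
    by apply: measurable_funB; exact: measurable_funM.
  by apply/funext => x; case: (f x); case: (g x).
- rewrite (_ : (fun _ => _) = (fun x =>
    complex.Re (f x) * complex.Im (g x) + complex.Im (f x) * complex.Re (g x))).
    by apply: measurable_funD; exact: measurable_funM.
  by apply/funext => x; case: (f x); case: (g x).
Qed.

Lemma measurable_cfun_conj D f : measurable_fun D f ->
  measurable_fun D (fun x => (f x)^* ).
Proof.
move=> /measurable_complexP[fr fi]; apply/measurable_complexP; split.
- rewrite (_ : (fun _ => _) = (fun x => complex.Re (f x))) //.
  by apply/funext => x; case: (f x).
- rewrite (_ : (fun _ => _) = (fun x => - complex.Im (f x))).
    exact: measurable_funN.
  by apply/funext => x; case: (f x).
Qed.

Lemma measurable_cfun_real D (h : T -> R) : measurable_fun D h ->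
  measurable_fun D (fun x => (h x)%:C%C).
Proof. by move=> mh; apply/measurable_complexP; split. Qed.

Lemma measurable_cfunV D f : measurable_fun D f ->
  measurable_fun D (fun x => (f x)^-1).
Proof.
move=> /measurable_complexP[fr fi]; apply/measurable_complexP.
(* The library has the measurability of powR but not of the inverse on R. *)
have mn : measurable_fun D (fun x =>
    (complex.Re (f x) ^+ 2 + complex.Im (f x) ^+ 2) `^ (-1)).
  apply: (measurableT_comp (f := fun y : R => y `^ (-1))).
    exact: measurable_powR.
  by apply: measurable_funD; exact: measurable_funX.
(* This also covers [f x = 0]: at base 0 both the power with exponent -1 and the field inverse are
   0. *)
have nE x : (complex.Re (f x) ^+ 2 + complex.Im (f x) ^+ 2) `^ (-1) =
    (complex.Re (f x) ^+ 2 + complex.Im (f x) ^+ 2)^-1.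
  by rewrite powR_inv1 // addr_ge0 // sqr_ge0.
split.
- apply: (eq_measurable_fun (fun x => complex.Re (f x) *
    (complex.Re (f x) ^+ 2 + complex.Im (f x) ^+ 2) `^ (-1))) => [x _|].
    by rewrite nE; case: (f x).
  exact: measurable_funM.
- apply: (eq_measurable_fun (fun x => - (complex.Im (f x) *
    (complex.Re (f x) ^+ 2 + complex.Im (f x) ^+ 2) `^ (-1)))) => [x _|].
    by rewrite nE; case: (f x) => a b /=; rewrite ?mulNr.
  by apply: measurable_funN; exact: measurable_funM.
Qed.

Lemma measurable_cfun_sum D I (s : seq I) (p : pred I) (h : I -> T -> R[i]) :
  (forall i, p i -> measurable_fun D (h i)) ->
  measurable_fun D (fun x => \sum_(i <- s | p i) h i x).
Proof.
move=> mh; elim: s => [|i s IH].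
  by apply: (eq_measurable_fun (cst (0 : R[i]))) => // x _; rewrite big_nil.
have [pi|/negPf pi] := boolP (p i); last first.
  by apply: eq_measurable_fun IH => x _; rewrite big_cons pi.
apply: (eq_measurable_fun (fun x => h i x + \sum_(j <- s | p j) h j x)).
  by move=> x _; rewrite big_cons pi.
by apply: measurable_cfunD => //; exact: mh.
Qed.

Lemma measurable_cfun_prod D I (s : seq I) (p : pred I) (h : I -> T -> R[i]) :
  (forall i, p i -> measurable_fun D (h i)) ->
  measurable_fun D (fun x => \prod_(i <- s | p i) h i x).
Proof.
move=> mh; elim: s => [|i s IH].
  by apply: (eq_measurable_fun (cst (1 : R[i]))) => // x _; rewrite big_nil.
have [pi|/negPf pi] := boolP (p i); last first.
  by apply: eq_measurable_fun IH => x _; rewrite big_cons pi.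
apply: (eq_measurable_fun (fun x => h i x * \prod_(j <- s | p j) h j x)).
  by move=> x _; rewrite big_cons pi.
by apply: measurable_cfunM => //; exact: mh.
Qed.

End complex_measurable_fun.

(** * Measurability of matrix operations *)

Lemma measurable_matrixP d1 d2 (T1 : measurableType d1) (T2 : measurableType d2)
    m n (f : T1 -> 'M[T2]_(m, n)) :
  measurable_fun setT f <-> forall i j, measurable_fun setT (fun x => f x i j).
Proof.
split=> [mf i j|mf].
  apply: (measurableT_comp (f := fun A : 'M[T2]_(m, n) => A i j)) => //.
  move=> _ A mA; apply: sub_sigma_algebra; exists (i, j) => //.
  by exists A.
apply: (measurability (\bigcup_(ij in [set: 'I_m * 'I_n])
   preimage_set_system setT (fun A : 'M[T2]_(m, n) => A ij.1 ij.2) measurable)).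
  by [].
move=> _ [_ [[i j] _ [A mA <-]] <-]; rewrite setTI.
exact: mf.
Qed.

Section matrix_measurable_fun.
Context d (T : measurableType d) (R : realType).

Lemma measurable_mxentry m n (i : 'I_m) (j : 'I_n) :
  measurable_fun setT (fun A : 'M[R[i]]_(m, n) => A i j).
Proof.
by have /measurable_matrixP := @measurable_id _ 'M[R[i]]_(m, n) setT.
Qed.

Lemma measurable_mulmx m n p (f : T -> 'M[R[i]]_(m, n))
    (g : T -> 'M[R[i]]_(n, p)) :
  measurable_fun setT f -> measurable_fun setT g ->
  measurable_fun setT (fun x => f x *m g x).
Proof.
move=> /measurable_matrixP mf /measurable_matrixP mg.
apply/measurable_matrixP => i j; under eq_fun do rewrite mxE.
by apply: measurable_cfun_sum => k _; exact: measurable_cfunM.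
Qed.

(** [\det] unfolds to the Leibniz formula, a finite sum of products of entries. *)
Lemma measurable_determinant n :
  measurable_fun setT (fun A : 'M[R[i]]_n => \det A).
Proof.
apply: measurable_cfun_sum => s _; apply: measurable_cfunM => //.
by apply: measurable_cfun_prod => i _; exact: measurable_mxentry.
Qed.

Lemma measurable_unitmx n : measurable [set A : 'M[R[i]]_n | A \in unitmx].
Proof.
rewrite [X in measurable X](_ : _ =
    ~` ((fun A => complex.Re (\det A)) @^-1` [set 0] `&`
        (fun A => complex.Im (\det A)) @^-1` [set 0])); last first.
  apply/seteqP; split=> A /=; rewrite unitmxE unitfE; case: (\det A) => a b /=.
    by move=> /eqP ab [a0 b0]; apply: ab; rewrite a0 b0.
  by move=> ab; apply/eqP => -[a0 b0]; apply: ab.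
have /measurable_complexP[mr mi] := @measurable_determinant n.
by apply: measurableC; apply: measurableI; rewrite -[X in measurable X]setTI;
  [apply: mr|apply: mi].
Qed.

End matrix_measurable_fun.

(** * Measurability of the QR factors *)

Section QR_measurable.
Context (R : realType) (N : nat).
Implicit Types Y U T : 'M[R[i]]_N.
Let D := [set Y : 'M[R[i]]_N | Y \in unitmx].

(** The determinant of [T] is the product of its positive diagonal; [T] is transposed because
    [det_trig] is about lower triangular matrices. Hence outside [D] there is no QR pair and [QR] is
    the constant default. *)
Lemma is_QR_unit Y U T : is_QR Y U T -> Y \in unitmx.
Proof.
move=> [-> Uu Ttri Tpos]; rewrite unitmx_mul unitarymx_unit//= -unitmx_tr.
rewrite unitmxE det_trig; last by apply/is_trig_mxP => i j ij; rewrite mxE Ttri.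
by rewrite unitfE; apply/prodf_neq0 => i _; rewrite mxE gt_eqF.
Qed.

Lemma QR_non_unit Y : Y \notin unitmx -> QR Y = (1%:M, 1%:M).
Proof. by move=> Yu; apply: xgetPN => UT /is_QR_unit; exact/negP. Qed.

Lemma QR_eq Y U T : is_QR Y U T -> QR Y = (U, T).
Proof.
move=> YUT; have := QR_P (is_QR_unit YUT).
by move=> /(is_QR_unique YUT)[-> ->]; case: (QR Y).
Qed.

(** The default value 1 is itself unitary, so this holds everywhere and not just almost surely, as
    the sectionwise use of invariance requires. *)
Lemma QR_unitary Y : (QR Y).1 \is unitarymx.
Proof.
have [/QR_P[]//|/QR_non_unit ->] := boolP (Y \in unitmx).
by apply/unitarymxP; rewrite trmx1 map_mx1 mulmx1.
Qed.

(* Gram-Schmidt: column j of Y minus its projection on the columns i < j of U,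
   and the norm of that difference. *)
Let V Y U (l j : 'I_N) : R[i] :=
  Y l j - \sum_(i < N | (i < j)%N) U l i * \sum_m (U m i)^* * Y m j.

Let rho Y U (j : 'I_N) : R[i] :=
  (Num.sqrt (complex.Re (\sum_l V Y U l j * (V Y U l j)^* )))%:C%C.

Let unitary_col U (i j : 'I_N) : U \is unitarymx ->
  \sum_m (U m i)^* * U m j = (i == j)%:R.
Proof.
move=> Uu; have /matrixP/(_ i j) := mulmxKtV 1%:M Uu erefl.
rewrite mul1mx [RHS]mxE => <-; rewrite mxE; apply: eq_bigr => m _.
by rewrite !mxE.
Qed.

(** This is [T = U^* Y] entrywise: it identifies the projection coefficients in [V], and it
    transfers measurability from the unitary factor to the triangular one. *)
Lemma is_QR_coef Y U T i j : is_QR Y U T -> \sum_m (U m i)^* * Y m j = T i j.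
Proof.
move=> [YE Uu _ _]; have UU : U^t* *m U = 1%:M.
  by have := mulmxKtV 1%:M Uu erefl; rewrite mul1mx.
rewrite -[T]mul1mx -UU -mulmxA -YE mxE; apply: eq_bigr => m _.
by rewrite !mxE.
Qed.

(** In the expansion of [Y l j] along row [l] of [U], the terms [i < j] are those subtracted in [V]
    and the terms [i > j] vanish by triangularity; only [i = j] is left. *)
Let gram_schmidtV Y U T l j : is_QR Y U T -> V Y U l j = U l j * T j j.
Proof.
move=> YUT; have [YE Uu Ttri _] := YUT; rewrite /V.
under eq_bigr do rewrite (is_QR_coef _ _ YUT).
rewrite YE mxE (bigID (fun i : 'I_N => (i < j)%N))/= addrC addrK.
rewrite (bigD1 j) ?ltnn//= big1 ?addr0// => i /andP[].
rewrite -leqNgt leq_eqVlt eq_sym => /orP[/eqP/val_inj -> /eqP//|ji _].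
by rewrite Ttri ?mulr0.
Qed.

Let gram_schmidt_rho Y U T j : is_QR Y U T -> rho Y U j = T j j.
Proof.
move=> YUT; rewrite /rho; under eq_bigr do rewrite (gram_schmidtV _ _ YUT).
have [_ Uu _ Tpos] := YUT; have Tj := ltW (Tpos j).
rewrite (eq_bigr (fun l => (U l j)^* * U l j * T j j ^+ 2)); last first.
  move=> l _.
  by rewrite rmorphM /= (geC0_conj Tj) mulrACA -expr2 [U l j * _]mulrC.
rewrite -mulr_suml unitary_col// eqxx mul1r.
(* In the order of [R[i]], nonnegativity forces a zero imaginary part, so the real square root of
   the squared norm gives back [T j j]. *)
move: Tj; case: (T j j) => a b; rewrite lecE /= => /andP[/eqP -> a0].
by rewrite !(mulr0, mul0r, subr0) -expr2 sqrtr_sqr ger0_norm.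
Qed.

Lemma measurable_QR_unitary i j :
  measurable_fun setT (fun Y : 'M[R[i]]_N => (QR Y).1 i j).
Proof.
(* Outside the measurable set [D] the function is constant. *)
suff mD : measurable_fun D (fun Y : 'M[R[i]]_N => (QR Y).1 i j).
  rewrite -(setvU D); apply/measurable_funU => //.
  - by apply: measurableC; exact: measurable_unitmx.
  - exact: measurable_unitmx.
  split=> //; apply: (eq_measurable_fun (cst ((1%:M : 'M[R[i]]_N) i j))) => //.
  by move=> Y /set_mem/negP/QR_non_unit ->.
(* Strong induction on the column: [V] at column [j] involves [U] only through the columns before
   [j], and dividing by [rho] gives column [j] of [U]. *)
have [m] := ubnP (val j); elim: m j i => // m IH j i jm.
have mV l : measurable_fun D (fun Y => V Y (QR Y).1 l j).
  have mY p q : measurable_fun D (fun Y : 'M[R[i]]_N => Y p q).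
    by apply: measurable_funTS; exact: measurable_mxentry.
  apply: measurable_cfunD => //; apply: measurable_cfunN.
  apply: measurable_cfun_sum => k kj.
  have mU p : measurable_fun D (fun Y => (QR Y).1 p k).
    by apply: IH; exact: leq_trans kj jm.
  apply: measurable_cfunM => //; apply: measurable_cfun_sum => p _.
  by apply: measurable_cfunM => //; exact: measurable_cfun_conj.
apply: (eq_measurable_fun (fun Y => V Y (QR Y).1 i j * (rho Y (QR Y).1 j)^-1)).
  move=> Y /set_mem/QR_P YUT.
  rewrite (gram_schmidtV _ _ YUT) (gram_schmidt_rho _ YUT).
  by have [_ _ _ Tpos] := YUT; rewrite mulfK// gt_eqF.
apply: measurable_cfunM => //; apply: measurable_cfunV.
apply: measurable_cfun_real.
apply: (measurableT_comp (f := @Num.sqrt R)).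
  by apply: continuous_measurable_fun; exact: sqrt_continuous.
apply: (measurableT_comp (f := @complex.Re R)); first exact: measurable_Re.
apply: measurable_cfun_sum => l _; apply: measurable_cfunM => //.
exact: measurable_cfun_conj.
Qed.

Lemma measurable_QR_R i j :
  measurable_fun setT (fun Y : 'M[R[i]]_N => QR_R Y i j).
Proof.
have mU k l : measurable_fun setT (fun Y : 'M[R[i]]_N => (QR Y).1 k l).
  exact: measurable_QR_unitary.
suff mD : measurable_fun D (fun Y : 'M[R[i]]_N => QR_R Y i j).
  rewrite -(setvU D); apply/measurable_funU => //.
  - by apply: measurableC; exact: measurable_unitmx.
  - exact: measurable_unitmx.
  split=> //; apply: (eq_measurable_fun (cst ((1%:M : 'M[R[i]]_N) i j))) => //.
  by move=> Y /set_mem/negP/QR_non_unit; rewrite /QR_R => ->.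
apply: (eq_measurable_fun (fun Y => \sum_m ((QR Y).1 m i)^* * Y m j)).
  by move=> Y /set_mem/QR_P; exact: is_QR_coef.
apply: measurable_funTS; apply: measurable_cfun_sum => m _.
apply: measurable_cfunM; last exact: measurable_mxentry.
exact: measurable_cfun_conj.
Qed.
End QR_measurable.

(** A product of upper triangular matrices is upper triangular with the diagonals multiplied
    entrywise, so the diagonal stays positive and uniqueness of QR identifies the factor. *)
Lemma QR_R_mulmx (R : realType) N (Y Z : 'M[R[i]]_N) (k : 'I_N) :
    Y \in unitmx -> Z \in unitmx ->
  QR_R (Y *m Z) k k = QR_R (Y *m (QR Z).1) k k * QR_R Z k k.
Proof.
move=> Yu Zu; have [ZE Uu Ttri Tpos] := QR_P Zu.
have : Y *m (QR Z).1 \in unitmx by rewrite unitmx_mul Yu unitarymx_unit.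
move=> /QR_P[YUE Uu' Ttri' Tpos'].
have diag (i : 'I_N) : ((QR (Y *m (QR Z).1)).2 *m (QR Z).2) i i =
    (QR (Y *m (QR Z).1)).2 i i * (QR Z).2 i i.
  rewrite mxE (bigD1 i)//= big1 ?addr0// => j; rewrite neq_ltn => /orP[ji|ij].
    by rewrite Ttri' ?mul0r.
  by rewrite Ttri ?mulr0.
suff /QR_eq : is_QR (Y *m Z) (QR (Y *m (QR Z).1)).1
    ((QR (Y *m (QR Z).1)).2 *m (QR Z).2) by rewrite /QR_R => ->; rewrite diag.
split=> //.
- by rewrite mulmxA -YUE -mulmxA -ZE.
- move=> i j ji; rewrite mxE big1// => l _.
  case: (ltnP l i) => [li|il]; first by rewrite Ttri' ?mul0r.
  by rewrite Ttri ?mulr0//; exact: leq_trans ji il.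
- by move=> i; rewrite diag mulr_gt0.
Qed.

(** * Joint laws and invariance under an independent random unitary *)

Section independence.
Context d (Omega : measurableType d) (R : realType) (P : probability Omega R).

(** Each preimage lies in the union of the other with a null set [M], which adds no mass; by
    symmetry one inequality suffices. *)
Lemma ae_eq_measure_preimage d' (T : measurableType d') (f g : Omega -> T)
    (B : set T) :
  measurable_fun setT f -> measurable_fun setT g ->
  {ae P, forall w, f w = g w} -> measurable B ->
  P (f @^-1` B) = P (g @^-1` B).
Proof.
move=> mf mg fg mB; pose sub (f' g' : Omega -> T) :=
  measurable_fun setT f' -> measurable_fun setT g' ->
  {ae P, forall w, f' w = g' w} -> (P (f' @^-1` B) <= P (g' @^-1` B))%E.
suff le f' g' : sub f' g'.
  by apply/eqP; rewrite eq_le !le//; apply: filterS fg.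
move=> mf' mg' [M [mM M0 f'g'M]].
have mpre (h : Omega -> T) : measurable_fun setT h -> measurable (h @^-1` B).
  by move=> mh; rewrite -[X in measurable X]setTI; exact: mh.
rewrite -[leRHS](measureU0 _ mM M0); last exact: mpre.
apply: le_measure; rewrite ?inE; first exact: mpre.
  by apply: measurableU => //; exact: mpre.
move=> w /= Bfw; have [<-|fgw] := pselect (f' w = g' w); first by left.
by right; apply: f'g'M.
Qed.

Lemma independent_RV_sym d1 d2 (T1 : measurableType d1) (T2 : measurableType d2)
    (X1 : {RV P >-> T1}) (X2 : {RV P >-> T2}) :
  independent_RV X1 X2 -> independent_RV X2 X1.
Proof. by move=> X12 B2 B1 mB2 mB1; rewrite setIC X12// muleC. Qed.

(** Independence is agreement of the two measures on rectangles, which determine the product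
    measure. *)
Lemma independent_RV_joint_law d1 d2 (T1 : measurableType d1)
    (T2 : measurableType d2) (X1 : {RV P >-> T1}) (X2 : {RV P >-> T2})
    (A : set (T1 * T2)) :
  independent_RV X1 X2 -> measurable A ->
  P ((fun w => (X1 w, X2 w)) @^-1` A) =
  (distribution P X1 \x distribution P X2)%E A.
Proof.
move=> X12 mA.
have mX : measurable_fun setT (fun w => (X1 w, X2 w)).
  exact: measurable_fun_pair.
pose X : {mfun Omega >-> (T1 * T2)%type} := mfun_Sub (mem_set mX).
apply/esym/(product_measure_unique (m' := distribution P X)) => //.
Qed.

Lemma right_unitarily_invariant_mulmx N d2 (T2 : measurableType d2)
    (Y : {RV P >-> 'M[R[i]]_N}) (X : {RV P >-> T2}) (g : T2 -> 'M[R[i]]_N)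
    (A : set (T2 * 'M[R[i]]_N)) :
  independent_RV Y X -> right_unitarily_invariant Y ->
  measurable_fun setT g -> (forall x, g x \is unitarymx) -> measurable A ->
  P ((fun w => (X w, Y w *m g (X w))) @^-1` A) =
  P ((fun w => (X w, Y w)) @^-1` A).
Proof.
move=> /independent_RV_sym YX Yinv mg gu mA.
pose h (z : T2 * 'M[R[i]]_N) := (z.1, z.2 *m g z.1).
have mh : measurable_fun setT h.
  apply: measurable_fun_pair => //; apply: measurable_mulmx => //.
  exact: measurableT_comp.
have mhA : measurable (h @^-1` A).
  by rewrite -[X in measurable X]setTI; exact: mh.
rewrite (independent_RV_joint_law YX mA).
rewrite -[LHS]/(P ((fun w => (X w, Y w)) @^-1` (h @^-1` A))).
(* The product measure integrates, over the first coordinate, the measure of the section. With [X]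
   placed first, [x] is frozen and [g x] is a deterministic unitary, so the invariance of [Y]
   applies to the section of [A] at [x]. *)
rewrite (independent_RV_joint_law YX mhA); apply: eq_integral => x _ /=.
have [_ _ E] := Yinv _ (gu x).
have := E _ (measurable_xsection x mA).
rewrite /distribution /pushforward => <-; congr (P _).
Qed.

End independence.

Theorem propositionB2 (R : realType) (d : measure_display)
  (Omega : measurableType d) (P : probability Omega R) (N : nat)
  (Y1 Y2 : {RV P >-> 'M[R[i]]_N}) :
  {ae P, forall w, Y1 w \in unitmx} ->
  {ae P, forall w, Y2 w \in unitmx} ->
  independent_RV Y1 Y2 ->
  right_unitarily_invariant Y1 ->
  right_unitarily_invariant Y2 ->
  forall k : 'I_N,
    eq_in_law P (fun w => QR_R (Y1 w *m Y2 w) k k)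
                (fun w => QR_R (Y1 w) k k * QR_R (Y2 w) k k).
Proof.
move=> Y1u Y2u Y12 Y1inv _ k.
pose h (z : 'M[R[i]]_N * 'M[R[i]]_N) := QR_R z.2 k k * QR_R z.1 k k.
have mY1 : measurable_fun setT Y1 by [].
have mY2 : measurable_fun setT Y2 by [].
have mRkk := @measurable_QR_R R N k k.
have mh : measurable_fun setT h.
  apply: measurable_cfunM.
    exact: (measurableT_comp mRkk measurable_snd).
  exact: (measurableT_comp mRkk measurable_fst).
have mU : measurable_fun setT (fun Z : 'M[R[i]]_N => (QR Z).1).
  by apply/measurable_matrixP; exact: measurable_QR_unitary.
have m3 : measurable_fun setT (fun w => QR_R (Y1 w *m Y2 w) k k).
  exact: (measurableT_comp mRkk (measurable_mulmx mY1 mY2)).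
have mYU : measurable_fun setT (fun w => (Y2 w, Y1 w *m (QR (Y2 w)).1)).
  apply: measurable_fun_pair => //; apply: measurable_mulmx => //.
  exact: (measurableT_comp mU mY2).
split=> //.
  apply: measurable_cfunM; first exact: (measurableT_comp mRkk mY1).
  exact: (measurableT_comp mRkk mY2).
move=> B mB.
have mhB : measurable (h @^-1` B).
  by rewrite -[X in measurable X]setTI; exact: mh.
rewrite -[RHS]/(P ((fun w => (Y2 w, Y1 w)) @^-1` (h @^-1` B))).
rewrite -(right_unitarily_invariant_mulmx Y12 Y1inv mU (@QR_unitary R N) mhB).
(* [Q] is [h] evaluated at the pair with the rotated [Y1]. It agrees with the diagonal entry for
   [Y1 *m Y2] where both matrices are invertible, hence almost surely. *)
pose Q w := QR_R (Y1 w *m (QR (Y2 w)).1) k k * QR_R (Y2 w) k k.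
apply: (@ae_eq_measure_preimage _ _ _ _ _ _ _ Q) => //.
  exact: (measurableT_comp mh mYU).
by apply: filterS2 Y1u Y2u => w Y1w Y2w; exact: QR_R_mulmx.
Qed.
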